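(* Let $\pi\in\mathbf I_n(3412)$ and $\Psi(\pi)=d_1\cdots d_n$. For each $1\le i\le n-2$, the word $\pi_i\pi_{i+1}\pi_{i+2}$ is order-isomorphic to the pattern determined by $d_id_{i+1}d_{i+2}$ as follows: $HHH\to123$, $HHU\to123$, $HHD\to231$; $HUH\to132$, $HUU\to132$, $HUD\to132$; $HDH\to213$, $HDU\to213$, $HDD\to321$; $UHH\to312$, $UHU\to312$, $UHD\to321$; $UUH\to321$, $UUU\to321$, $UUD\to321$; $UDH\to213$, $UDU\to213$, $UDD\to321$; $DHH\to123$, $DHU\to123$, $DHD\to231$; $DUH\to132$, $DUU\to132$, $DUD\to132$; $DDH\to213$, $DDU\to213$, $DDD\to321$.
   Context: $\mathbf I_n(3412)$ is the set of involutions of $\{1,\dots,n\}$ with no subsequence order-isomorphic to $3412$. For an involution $\pi$, $\Psi(\pi)$ is the Motzkin path $d_1\cdots d_n$ (steps $U=(1,1)$, $D=(1,-1)$, $H=(1,0)$) with $d_i=H$ if $i$ is a fixed point, $d_i=U$ if $i$ is the smaller element of a 2-cycle, $d_i=D$ if $i$ is the larger element of a 2-cycle. *)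

(* Defs.v *)
From mathcomp Require Import all_boot all_fingroup.

Set Implicit Arguments.
Unset Strict Implicit.
Unset Printing Implicit Defensive.

Definition order_iso (u v : seq nat) : Prop :=
  size u = size v /\
  forall j k : nat, j < size u -> k < size u ->
    (nth 0 u j < nth 0 u k) = (nth 0 v j < nth 0 v k).

Definition contains (p w : seq nat) : Prop :=
  exists2 s : seq nat, subseq s w & order_iso s p.

(* {1, ..., n} is represented by 'I_n, with the number i encoded by the ordinal
   of value i.-1; the letters of the one-line word are shifted back to 1..n. *)
Definition oneline (n : nat) (pi : 'S_n) : seq nat :=
  [seq (pi i).+1 | i <- enum 'I_n].

Definition invol_avoiding (n : nat) (p : seq nat) (pi : 'S_n) : Prop :=
  involutive pi /\ ~ contains p (oneline pi).

Inductive step : Type := U | D | H.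

(* For an involution, i < pi i says that i is the smaller element of the
   2-cycle (i, pi i), and pi i < i that it is the larger one. *)
Definition Psi (n : nat) (pi : 'S_n) : seq step :=
  [seq (if pi i == i then H else if i < pi i then U else D) | i <- enum 'I_n].

(* Both accessors are indexed from 1. *)
Definition letter (n : nat) (pi : 'S_n) (i : nat) : nat :=
  nth 0 (oneline pi) i.-1.

Definition Psi_step (n : nat) (pi : 'S_n) (i : nat) : step :=
  nth H (Psi pi) i.-1.

Definition step_pattern (a b c : step) : seq nat :=
  match a, b, c with
  | H, H, H => [:: 1; 2; 3]
  | H, H, U => [:: 1; 2; 3]
  | H, H, D => [:: 2; 3; 1]
  | H, U, H => [:: 1; 3; 2]
  | H, U, U => [:: 1; 3; 2]
  | H, U, D => [:: 1; 3; 2]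
  | H, D, H => [:: 2; 1; 3]
  | H, D, U => [:: 2; 1; 3]
  | H, D, D => [:: 3; 2; 1]
  | U, H, H => [:: 3; 1; 2]
  | U, H, U => [:: 3; 1; 2]
  | U, H, D => [:: 3; 2; 1]
  | U, U, H => [:: 3; 2; 1]
  | U, U, U => [:: 3; 2; 1]
  | U, U, D => [:: 3; 2; 1]
  | U, D, H => [:: 2; 1; 3]
  | U, D, U => [:: 2; 1; 3]
  | U, D, D => [:: 3; 2; 1]
  | D, H, H => [:: 1; 2; 3]
  | D, H, U => [:: 1; 2; 3]
  | D, H, D => [:: 2; 3; 1]
  | D, U, H => [:: 1; 3; 2]
  | D, U, U => [:: 1; 3; 2]
  | D, U, D => [:: 1; 3; 2]
  | D, D, H => [:: 2; 1; 3]
  | D, D, U => [:: 2; 1; 3]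
  | D, D, D => [:: 3; 2; 1]
  end.

(* Main.v *)
Require Import Defs.
From mathcomp Require Import all_boot all_fingroup.
From mathcomp Require Import zify.

(** Draw an involution as a set of arcs, one for each 2-cycle.  Two crossing
    arcs [a < b < pi a < pi b] are an occurrence of 3412 at the positions
    [a, b, pi a, pi b], so the arcs of a 3412-avoiding involution do not cross.
    The steps at three consecutive positions say on which side the partner of
    each position lies, and the absence of crossings then fixes the relative
    order of the three partners. *)

Lemma sorted_subseq_iota (s : seq nat) (n : nat) :
  sorted ltn s -> all (fun k => k < n) s -> subseq s (iota 0 n).
Proof.
move=> s_sorted /allP s_lt_n.
(* A strictly increasing list is determined by its set of elements. *)
rewrite (_ : s = [seq k <- iota 0 n | k \in s]) ?filter_subseq //.
apply: (irr_sorted_eq ltn_trans ltnn) => // [|k].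
  exact: (sorted_filter ltn_trans) (iota_ltn_sorted 0 n).
by rewrite mem_filter mem_iota add0n andb_idr // => /s_lt_n.
Qed.

Lemma sorted_subseq_enum_ord (n : nat) (s : seq 'I_n) :
  sorted ltn (map val s) -> subseq s (enum 'I_n).
Proof.
move=> s_sorted.
have /(sorted_subseq_iota _ n s_sorted) : all (fun k => k < n) (map val s).
  by apply/allP => _ /mapP[k _ ->] /=.
by rewrite -val_enum_ord => /subseqP[m sz_m /eqP];
   rewrite -map_mask (inj_eq (inj_map val_inj)) => /eqP->; apply: mask_subseq.
Qed.

Lemma crossing_contains_3412 (n : nat) (pi : 'S_n) (a b : 'I_n) :
  involutive pi -> a < b -> b < pi a -> pi a < pi b ->
  contains [:: 3; 4; 1; 2] (oneline pi).
Proof.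
move=> piK lt_ab lt_bc lt_cd.
exists [seq (pi k).+1 | k <- [:: a; b; pi a; pi b]].
  by apply/map_subseq/sorted_subseq_enum_ord; rewrite /= lt_ab lt_bc lt_cd.
split=> //= [[|[|[|[|j]]]]] [|[|[|[|k]]]] //= _ _; rewrite ?piK; lia.
Qed.

(** If [b] lies strictly under the arc from [a] to [pi a], a partner of [b] outside that arc, on
    either side, would create a crossing. *)
Lemma nested_right (n : nat) (pi : 'S_n) (a b : 'I_n) :
  invol_avoiding [:: 3; 4; 1; 2] pi -> a < b -> b <= pi a -> a <= pi b <= pi a.
Proof.
move=> [piK avoid] lt_ab; rewrite leq_eqVlt => /predU1P[/val_inj eq_b|lt_b].
  by rewrite eq_b piK leqnn -eq_b ltnW.
apply/andP; split; rewrite leqNgt; apply/negP => lt_pib; apply: avoid.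
  (* Here [pi b < a < b < pi a], so [pi b] is the leftmost endpoint of the crossing. *)
  by apply: (crossing_contains_3412 _ _ (pi b) a); rewrite ?piK.
exact: (crossing_contains_3412 _ _ a b).
Qed.

(** Mirror image of [nested_right]: when [pi b < a], apply it to the positions [pi b] and [a]. *)
Lemma nested_left (n : nat) (pi : 'S_n) (a b : 'I_n) :
  invol_avoiding [:: 3; 4; 1; 2] pi -> a < b -> pi b <= a -> pi b <= pi a <= b.
Proof.
move=> Hpi lt_ab; have piK := Hpi.1.
rewrite leq_eqVlt => /predU1P[/val_inj eq_a|lt_a].
  by rewrite -eq_a piK leqnn andbT eq_a ltnW.
by have := nested_right _ _ _ _ Hpi lt_a; rewrite piK; apply; apply: ltnW.
Qed.

Lemma ltn_permC (n : nat) (pi : 'S_n) (a b : 'I_n) :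
  a < b -> (pi a < pi b) = ~~ (pi b < pi a).
Proof.
move=> lt_ab; rewrite -leqNgt ltn_neqAle (inj_eq val_inj) (inj_eq perm_inj).
by rewrite -(inj_eq val_inj) ltn_eqF.
Qed.

(** By adjacency, [a < pi a] gives [b <= pi a], and [pi b < b] gives [pi b <= a], so a nesting lemma
    applies. Otherwise [pi a <= a < b <= pi b]. *)
Lemma desc_adjacent (n : nat) (pi : 'S_n) (a b : 'I_n) :
  invol_avoiding [:: 3; 4; 1; 2] pi -> b = a.+1 :> nat ->
  (pi b < pi a) = (a < pi a) || (pi b < b).
Proof.
move=> Hpi ab; have lt_ab : a < b by rewrite ab.
have := nested_right _ _ _ _ Hpi lt_ab; have := nested_left _ _ _ _ Hpi lt_ab.
have := ltn_permC _ pi _ _ lt_ab; lia.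
Qed.

(** In the first disjunct [b <= pi b < pi a], so [c <= pi a] and [nested_right] applies to [a] and
    [c]; the second is its mirror image. If both fail, either [pi a <= a < c <= pi c], or the arc of
    [b] forces [pi a <= b < c <= pi c] ([b] closes) or [pi a <= a < b <= pi c] ([b] opens). *)
Lemma desc_gap2 (n : nat) (pi : 'S_n) (a b c : 'I_n) :
  invol_avoiding [:: 3; 4; 1; 2] pi ->
  b = a.+1 :> nat -> c = b.+1 :> nat ->
  (pi c < pi a) = (a < pi a) && (b <= pi b) || (pi c < c) && (pi b <= b).
Proof.
move=> Hpi ab bc.
have lt_ab : a < b by rewrite ab.
have lt_bc : b < c by rewrite bc.
have lt_ac := ltn_trans lt_ab lt_bc.
have perm_ac := ltn_permC _ pi _ _ lt_ac.
have desc_ab := desc_adjacent _ _ _ _ Hpi ab.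
have desc_bc := desc_adjacent _ _ _ _ Hpi bc.
have right_ac := nested_right _ _ _ _ Hpi lt_ac.
have left_ac := nested_left _ _ _ _ Hpi lt_ac.
have left_ab := nested_left _ _ _ _ Hpi lt_ab.
have right_bc := nested_right _ _ _ _ Hpi lt_bc.
case: (ltnP a (pi a)) => Ha /=; case: (leqP b (pi b)) => Hb /=.
- clear left_ac left_ab right_bc desc_bc; lia.
- case: (ltnP (pi c) c) => Hc; clear right_ac right_bc desc_ab; lia.
- case: (ltnP (pi c) c) => Hc; clear right_ac left_ab desc_ab; lia.
- clear right_ac left_ab right_bc desc_ab; lia.
Qed.

Lemma letterE (n : nat) (pi : 'S_n) (k : 'I_n) : letter pi k.+1 = (pi k).+1.
Proof. by rewrite /letter (nth_map k) ?size_enum_ord ?ltn_ord // nth_ord_enum. Qed.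

Lemma Psi_stepE (n : nat) (pi : 'S_n) (k : 'I_n) :
  Psi_step pi k.+1 =
  if pi k == k :> nat then H else if k < pi k then U else D.
Proof.
by rewrite /Psi_step (nth_map k) ?size_enum_ord ?ltn_ord // nth_ord_enum.
Qed.

Theorem theorem4p1 (n : nat) (pi : 'S_n)
    (Hpi : invol_avoiding [:: 3; 4; 1; 2] pi) (i : nat)
    (Hi : 1 <= i <= n - 2) :
  order_iso [:: letter pi i; letter pi i.+1; letter pi i.+2]
            (step_pattern (Psi_step pi i) (Psi_step pi i.+1)
                          (Psi_step pi i.+2)).
Proof.
case: i Hi => [|x] // Hi.
have [x0 x1 x2] : [/\ x < n, x.+1 < n & x.+2 < n] by split; lia.
set a := Ordinal x0; set b := Ordinal x1; set c := Ordinal x2.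
rewrite (letterE _ pi a) (letterE _ pi b) (letterE _ pi c).
rewrite (Psi_stepE _ pi a) (Psi_stepE _ pi b) (Psi_stepE _ pi c).
have ba : (pi b < pi a) = _ := desc_adjacent _ _ a b Hpi erefl.
have cb : (pi c < pi b) = _ := desc_adjacent _ _ b c Hpi erefl.
have ca : (pi c < pi a) = _ := desc_gap2 _ _ a b c Hpi erefl erefl.
have ab : (pi a < pi b) = _ := ltn_permC _ pi a b (ltnSn x).
have bc : (pi b < pi c) = _ := ltn_permC _ pi b c (ltnSn x.+1).
have ac : (pi a < pi c) = _ := ltn_permC _ pi a c (leqnSn x.+1).
(* All six comparisons now depend only on the three steps, so each of the 27 cases below is a
   computation. *)
move: ab bc ac; rewrite ba cb ca; move: ba cb ca.
case: (ltngtP (pi a) a) => _; case: (ltngtP (pi b) b) => _;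
case: (ltngtP (pi c) c) => _ /= ba cb ca ab bc ac;
by split=> //= [[|[|[|j]]]] [|[|[|k]]] //= _ _;
   rewrite ltnS ?ltnn ?ab ?bc ?ac ?ba ?cb ?ca.
Qed.
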